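(* Fix an integer $d\geq 2$ and a real number $q\geq 1$. Then $$\lim_{p\to\infty}\frac{\delta\!\left(H_q^+(d,p)\right)}{p^d}=\frac{\Gamma\!\left(\frac{1}{q}+1\right)^d}{\Gamma\!\left(\frac{d}{q}+1\right)\zeta(d)}.$$
   Context: A point of $\mathbb{Z}^d$ is primitive if it is nonzero and the greatest common divisor of its coordinates is $1$. For $p>0$, $H_q^+(d,p)$ is the zonotope (Minkowski sum of segments) $\sum_x [0,x]$, where $x$ ranges over all primitive points of $\mathbb{Z}^d$ with $\|x\|_q\leq p$ and all coordinates nonnegative. For a polytope $P$, $\delta(P)$ denotes the diameter of the graph of $P$ (vertices and edges). $\Gamma$ is Euler's gamma function and $\zeta$ the Riemann zeta function. *)

(* Defs.v *)
From HB Require Import structures.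
From mathcomp Require Export all_boot all_order all_algebra.
From mathcomp Require Export all_classical all_reals all_analysis.

Set Implicit Arguments.
Unset Strict Implicit.
Unset Printing Implicit Defensive.

Import Order.TTheory GRing.Theory Num.Theory.
Import numFieldNormedType.Exports.

Local Open Scope classical_set_scope.
Local Open Scope ring_scope.

Section Polytopes.
Variables (R : realType) (d : nat).
Implicit Types (P F A B : set 'rV[R]_d) (u v : 'rV[R]_d).

Definition dotp (c x : 'rV[R]_d) : R := \sum_i c 0 i * x 0 i.

Definition segment u v : set 'rV[R]_d :=
  [set (1 - t) *: u + t *: v | t in [set t : R | 0 <= t <= 1]].

Definition minkowski_sum A B : set 'rV[R]_d := [set a + b | a in A & b in B].

Definition is_face P F : Prop :=
  exists (c : 'rV[R]_d) (b : R),
    (forall y, P y -> dotp c y <= b) /\ F = P `&` [set x | dotp c x = b].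

Definition vertices P : set 'rV[R]_d := [set v | is_face P [set v]].

(* A one-dimensional face of a polytope is the segment joining the two
   distinct vertices that it contains. *)
Definition adjacent P u v : Prop :=
  [/\ vertices P u, vertices P v, u <> v & is_face P (segment u v)].

(* The distance is +oo when no path joins the two vertices. *)
Definition graph_dist P u v : \bar R :=
  ereal_inf [set ((size s)%:R)%:E | s in
    [set s : seq 'rV[R]_d |
       path (fun x y => `[< adjacent P x y >]) u s /\ last u s = v]].

Definition diameter P : \bar R :=
  ereal_sup [set graph_dist P w.1 w.2 | w in vertices P `*` vertices P].

End Polytopes.

Section PrimitiveZonotope.
Variables (R : realType) (d : nat).

Definition primitive_point (x : 'rV[int]_d) : Prop :=
  x <> 0 /\ \big[gcdn/0%N]_(i < d) absz (x 0%R i) = 1%N.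

Definition qnorm (q : R) (x : 'rV[R]_d) : R :=
  (\sum_i `|x 0 i| `^ q) `^ q^-1.

Definition int_point (x : 'rV[int]_d) : 'rV[R]_d := map_mx intr x.

Definition generators (q p : R) : set 'rV[int]_d :=
  [set x | [/\ primitive_point x, qnorm q (int_point x) <= p
             & forall i, 0 <= x 0 i]].

(* This is a big operation over a set of finite support; the support is indeed
   finite since [generators q p] is a finite set when 0 < q. *)
Definition Hplus (q p : R) : set 'rV[R]_d :=
  \big[@minkowski_sum R d/[set 0]]_(x \in generators q p)
    segment 0 (int_point x).

End PrimitiveZonotope.

Arguments Hplus {R} d q p.

Definition Gamma (R : realType) (s : R) : R :=
  \int[lebesgue_measure]_(t in `]0, +oo[) (t `^ (s - 1) * expR (- t)).

Definition zeta (R : realType) (s : R) : R :=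
  limn (series (fun n : nat => (n.+1%:R : R) `^ (- s))).

(* Main.v *)
(* For a zonotope Z with n pairwise non-collinear generators in an open
   half-space, a vertex is determined by the signs of a generic functional on the
   generators, an edge flips exactly one sign, and a generic segment between two
   functionals changes the signs one at a time. Two opposite functionals differ in
   all n signs, so the diameter of the graph of Z is n.  Distinct primitive points
   with nonnegative coordinates are not collinear, hence the diameter of the
   zonotope counts the primitive lattice points of the positive part of the
   q-ball of radius p.

   Let L(p) count all the lattice points of that region.  Since
   L(n p) <= n^d L(p), the quotient L(p) / p^d tends to its infimum V.  Sorting
   nonzero points by gcd gives L(p) - 1 = sum_k N(p / k) with N the primitive
   count, and as zeta(d) - 1 < 1 this recursion forces N(p) / p^d -> V / zeta(d).

   The volume V is computed without a change of variables: with the sums over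
   0 <= k <= n^2 and over the corresponding box,
     ((1/n) sum_k exp(-(k/n)^q))^d = n^-d sum_x exp(-sum_i (x_i/n)^q)
       = int_0^oo exp(-t) #{x : sum_i (x_i/n)^q <= t} / n^d dt
       -> V int_0^oo exp(-t) t^(d/q) dt = V Gamma(d/q + 1)
   by dominated convergence.  For d = 1 one has V = 1, so the bracket tends to
   Gamma(1/q + 1). *)

Require Import Defs.
From mathcomp Require Import all_boot all_order all_algebra.
From mathcomp Require Import all_classical all_reals all_analysis.
From mathcomp Require Import measurable_realfun.
From mathcomp Require Import ring lra.
Import Order.TTheory GRing.Theory Num.Theory.
Import numFieldNormedType.Exports.
Local Open Scope classical_set_scope.
Local Open Scope ring_scope.

(** * Diameter of a zonotope *)

Section Zonotope.
Variables (R : realType) (d : nat).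
Implicit Types c u v w x y : 'rV[R]_d.

Lemma dotpDl c c' x : dotp (c + c') x = dotp c x + dotp c' x.
Proof.
by rewrite -big_split; apply: eq_bigr => i _; rewrite mxE mulrDl.
Qed.

Lemma dotpZl (a : R) c x : dotp (a *: c) x = a * dotp c x.
Proof. by rewrite mulr_sumr; apply: eq_bigr => i _; rewrite mxE mulrA. Qed.

Lemma dotpC c x : dotp c x = dotp x c.
Proof. by apply: eq_bigr => i _; rewrite mulrC. Qed.

Lemma dotpDr c x y : dotp c (x + y) = dotp c x + dotp c y.
Proof. by rewrite dotpC dotpDl !(dotpC _ c). Qed.

Lemma dotpZr (a : R) c x : dotp c (a *: x) = a * dotp c x.
Proof. by rewrite dotpC dotpZl dotpC. Qed.

Lemma dotp_sumr (J : Type) (s : seq J) (F : J -> 'rV[R]_d) c :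
  dotp c (\sum_(j <- s) F j) = \sum_(j <- s) dotp c (F j).
Proof.
elim/big_rec2: _ => [|j y1 y2 _ <-]; last by rewrite dotpDr.
by rewrite /dotp big1 // => i _; rewrite mxE mulr0.
Qed.

Lemma dotpp_gt0 x : x != 0 -> 0 < dotp x x.
Proof.
move=> x0; rewrite lt_neqAle; apply/andP; split; last first.
  by apply: sumr_ge0 => i _; rewrite -expr2 sqr_ge0.
apply: contra_neq x0 => /esym/psumr_eq0P x2; apply/rowP => i; rewrite mxE.
by apply/eqP; rewrite -sqrf_eq0 expr2 x2 // => j _; rewrite -expr2 sqr_ge0.
Qed.

(** * Sign-preserving perturbation of functionals *)

Lemma sign_stable c w (s : seq 'rV[R]_d) :
  (forall h, h \in s -> dotp c h != 0) ->
  exists2 e : R, 0 < e &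
    forall h, h \in s -> 0 < dotp c h * dotp (c + e *: w) h.
Proof.
(* The claim is strengthened to all [t] in [[0, e]], so that the induction may shrink [e] to a
   minimum. *)
move=> s0; suff [e e0 es] : exists2 e : R, 0 < e &
    forall t : R, 0 <= t <= e -> forall h, h \in s -> 0 < dotp c h * dotp (c + t *: w) h.
  by exists e => // h hs; apply: es; rewrite ?lexx ?ltW.
elim: s s0 => [|h s IH] s0; first by exists 1.
have [|e e0 es] := IH; first by move=> k ks; apply: s0; rewrite inE ks orbT.
have h0 : dotp c h != 0 by apply: s0; rewrite inE eqxx.
set a := dotp c h in h0; set b := dotp w h.
have a0 : 0 < `|a| by rewrite normr_gt0.
have b1 : 0 < `|b| + 1 by rewrite ltr_wpDl.
(* The second bound forces [t * |b| < |a|]; the added 1 gives strictness and avoids division by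
   zero. *)
exists (Num.min e (`|a| / (`|b| + 1))).
  by rewrite lt_min e0 divr_gt0.
move=> t; rewrite le_min => /and3P[t0 te ta] k; rewrite inE => /predU1P[->|ks].
- rewrite dotpDl dotpZl -/a -/b.
  rewrite ler_pdivlMr // in ta.
  have tb : t * `|b| < `|a|.
    case: (eqVneq t 0) ta => [->|tn0]; first by rewrite !mul0r.
    have : 0 < t by rewrite lt_neqAle eq_sym tn0.
    rewrite mulrDr mulr1; lra.
  rewrite mulrDr -expr2 -real_normK ?num_real //.
  have : - (a * (t * b)) <= `|a| * (t * `|b|).
    by rewrite (le_trans (ler_norm _)) // normrN !normrM (ger0_norm t0).
  have : `|a| * (t * `|b|) < `|a| ^+ 2 by rewrite expr2 ltr_pM2l.
  lra.
- by apply: es; rewrite ?t0.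
Qed.

Lemma mulr_gt0_trans (a b e : R) : 0 < a * b -> 0 < b * e -> 0 < a * e.
Proof.
move=> ab be; have b2 : 0 < b ^+ 2.
  by rewrite exprn_even_gt0 //=; case: eqP ab => // ->; rewrite mulr0 ltxx.
rewrite -(pmulr_rgt0 _ b2).
have -> : b ^+ 2 * (a * e) = a * b * (b * e) by ring.
exact: mulr_gt0.
Qed.

Lemma mulr_gt0_sign (a b : R) : 0 < a * b -> (0 < b) = (0 < a).
Proof.
case: (ltrgtP 0 a) => [a0|a0|<-]; last by rewrite mul0r ltxx.
  by rewrite pmulr_rgt0.
by rewrite nmulr_rgt0 // => b0; apply/negbTE; rewrite -leNgt ltW.
Qed.

(** The vectors of [s] are treated one by one by small moves. A vector once made non-orthogonal
    joins [s0], so later moves keep its sign. A positive product encodes equal nonzero signs. *)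
Lemma perturb c (s0 s : seq 'rV[R]_d) :
  (forall h, h \in s0 -> dotp c h != 0) -> (forall h, h \in s -> h != 0) ->
  exists2 c', forall h, h \in s0 -> 0 < dotp c h * dotp c' h &
              forall h, h \in s -> dotp c' h != 0.
Proof.
elim: s s0 c => [|h s IH] s0 c cs0 s_neq0.
  by exists c => // h /cs0; rewrite -expr2 exprn_even_gt0.
have sn0 k : k \in s -> k != 0 by move=> ks; apply: s_neq0; rewrite inE ks orbT.
have [c1 c1s c1h] : exists2 c1,
    forall k, k \in s0 -> 0 < dotp c k * dotp c1 k & dotp c1 h != 0.
  case: (eqVneq (dotp c h) 0) => [ch0|chn0]; last first.
    by exists c => // k /cs0; rewrite -expr2 exprn_even_gt0.
  have [e e0 es] := sign_stable _ h _ cs0.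
  (* Moving in the direction [h] itself works because [dotp h h > 0]. *)
  exists (c + e *: h) => //; rewrite dotpDl ch0 add0r dotpZl gt_eqF //.
  by rewrite mulr_gt0 // dotpp_gt0 // s_neq0 // inE eqxx.
have [|c' c'0 c's] := IH (h :: s0) c1 _ sn0.
  move=> k; rewrite inE => /predU1P[->//|/c1s].
  by case: eqP => // ->; rewrite mulr0 ltxx.
exists c' => k; last first.
  rewrite inE => /predU1P[->|/c's//].
  have := c'0 h; rewrite inE eqxx => /(_ isT).
  by case: eqP => // ->; rewrite mulr0 ltxx.
move=> ks; have c1k := c1s _ ks; have := c'0 k; rewrite inE ks orbT => /(_ isT).
exact: mulr_gt0_trans.
Qed.

(** * Faces and vertices of a zonotope *)

Variables (I : finType) (g : I -> 'rV[R]_d).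
Implicit Types t : I -> R.

Definition zonotope : set 'rV[R]_d :=
  [set \sum_i t i *: g i | t in [set t : I -> R | forall i, 0 <= t i <= 1]].

(** The support function of the zonotope; [zvtx c] below is a point where it is attained. *)
Definition zsupp c : R := \sum_i Num.max 0 (dotp c (g i)).

Definition zvtx c : 'rV[R]_d := \sum_i (0 < dotp c (g i))%R%:R *: g i.

Definition zgeneric c := forall i, dotp c (g i) != 0.

(** For generic [c] and [c'], these index the hyperplanes orthogonal to the generators that separate
    them; the cardinality turns out to be the graph distance. *)
Definition zsep c c' : {set I} :=
  [set i | (0 < dotp c (g i)) != (0 < dotp c' (g i))].

Lemma dotp_zsum c t :
  dotp c (\sum_i t i *: g i) = \sum_i t i * dotp c (g i).
Proof. by rewrite dotp_sumr; apply: eq_bigr => i _; rewrite dotpZr. Qed.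

Lemma mulr_le_max0 (a b : R) : 0 <= a <= 1 -> a * b <= Num.max 0 b.
Proof.
by move=> /andP[a0 a1]; rewrite le_max; case: (lerP b 0) => b0; nra.
Qed.

Lemma zonotope_le c y : zonotope y -> dotp c y <= zsupp c.
Proof.
move=> [t t01 <-]; rewrite dotp_zsum; apply: ler_sum => i _.
exact: mulr_le_max0.
Qed.

(** The bound holds termwise, so equality of the sums forces equality in each term: a coefficient is
    free exactly where [c] vanishes on its generator. *)
Lemma zonotope_max c t : (forall i, 0 <= t i <= 1) ->
  dotp c (\sum_i t i *: g i) = zsupp c <->
  forall i, dotp c (g i) != 0 -> t i = (0 < dotp c (g i))%R%:R.
Proof.
move=> t01; rewrite dotp_zsum; split => [E i ci|E].
- have /psumr_eq0P E0 :
      \sum_i (Num.max 0 (dotp c (g i)) - t i * dotp c (g i)) = 0.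
    by rewrite sumrB E subrr.
  have {E0}/eqP : Num.max 0 (dotp c (g i)) - t i * dotp c (g i) = 0.
    by apply: E0 => // j _; rewrite subr_ge0 mulr_le_max0.
  rewrite subr_eq0 maxEle; case: (ltrgtP (dotp c (g i)) 0) ci => // c0 _.
    by rewrite eq_sym mulf_eq0 (lt_eqF c0) orbF => /eqP.
  by rewrite -{1}(mul1r (dotp c _)) => /eqP/(mulIf (lt0r_neq0 c0)) <-.
- apply: eq_bigr => i _; case: (eqVneq (dotp c (g i)) 0) => [->|ci].
    by rewrite mulr0 maxxx.
  rewrite E //; case: (ltrgtP (dotp c (g i)) 0) ci => // c0 _.
    by rewrite mul0r.
  by rewrite mul1r.
Qed.

Lemma bool01 (b : bool) : 0 <= (b%:R : R) <= 1.
Proof. by case: b; rewrite ?lexx ler01. Qed.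

Lemma zvtx_in c : zonotope (zvtx c).
Proof. by exists (fun i => (0 < dotp c (g i))%R%:R) => // i; apply: bool01. Qed.

Lemma dotp_zvtx c : dotp c (zvtx c) = zsupp c.
Proof. by apply/zonotope_max => // i; apply: bool01. Qed.

(** On a nonempty face the bound [b] is attained, and [zvtx c] attains the support function, so the
    two values agree. *)
Lemma zonotope_face F y : is_face zonotope F -> F y ->
  exists e, F = zonotope `&` [set x | dotp e x = zsupp e].
Proof.
move=> [c [b [cb ->]]] [Zy /= cy]; exists c; congr (_ `&` _).
suff -> : b = zsupp c by [].
apply: le_anti; rewrite -{1}cy zonotope_le //= -dotp_zvtx cb //.
exact: zvtx_in.
Qed.

Lemma zsupp_face e : is_face zonotope (zonotope `&` [set x | dotp e x = zsupp e]).
Proof. by exists e, (zsupp e); split => // y; apply: zonotope_le. Qed.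

Lemma zvtx_vertex c : zgeneric c -> vertices zonotope (zvtx c).
Proof.
move=> gc; rewrite /vertices /=.
suff -> : [set zvtx c] = zonotope `&` [set x | dotp c x = zsupp c].
  exact: zsupp_face.
apply/seteqP; split => x /=.
  by move=> ->; split; [exact: zvtx_in|exact: dotp_zvtx].
move=> [[t t01 <-]] /(zonotope_max _ _ t01) E.
by apply: eq_bigr => i _; rewrite E.
Qed.

(** The common point maximizes [c], and genericity of [c] then prescribes every coefficient,
    including the indicators coming from [c']. *)
Lemma zvtx_eq c c' : zgeneric c -> zvtx c = zvtx c' ->
  forall i, (0 < dotp c (g i)) = (0 < dotp c' (g i)).
Proof.
move=> gc E i; have := dotp_zvtx c; rewrite E.
move/zonotope_max => /(_ (fun i => bool01 _)) /(_ i (gc i)) /eqP.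
by rewrite eqr_nat; do 2!case: (0 < _).
Qed.

Hypothesis gn0 : forall i, g i != 0.

(** If the functional exposing [v] vanished on some [g i], then [zvtx c + g i] would be a second
    point of the face. *)
Lemma vertex_zvtx v : vertices zonotope v ->
  exists2 c, zgeneric c & v = zvtx c.
Proof.
move=> /zonotope_face /(_ erefl) [c E].
have cv : [set v] (zvtx c).
  by rewrite E; split; [exact: zvtx_in|exact: dotp_zvtx].
exists c => // i; apply/eqP => ci.
(* The coefficients of [zvtx c + g i]; they stay in [[0, 1]] because the indicator is 0 at [i]. *)
pose t j := (0 < dotp c (g j))%R%:R + (j == i)%:R : R.
have t01 j : 0 <= t j <= 1.
  rewrite /t; case: eqP => [->|_]; last by rewrite addr0 bool01.
  by rewrite ci ltxx add0r ler01 lexx.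
have : [set v] (\sum_i t i *: g i).
  rewrite E; split; first by exists t.
  apply/(zonotope_max _ _ t01) => j cj; rewrite /t.
  case: (eqVneq j i) cj => [->|_ _]; first by rewrite ci eqxx.
  by rewrite addr0.
rewrite /= -cv /zvtx; move/eqP; rewrite -subr_eq0 -sumrB (bigD1 i) //= big1 => [|j ji].
  by rewrite /t eqxx ci ltxx add0r scale1r scale0r subr0 addr0 (negPf (gn0 i)).
by rewrite /t (negPf ji) addr0 subrr.
Qed.

(** * Edges and graph distance *)

Hypothesis gind : forall i j (a b : R), i != j ->
  a *: g i + b *: g j = 0 -> a = 0 /\ b = 0.

(** The functional exposing an edge vanishes on every generator where the two signs differ. Such a
    generator is parallel to the edge, and independence leaves room for only one. *)
Lemma adjacent_zsep c c' : Defs.adjacent zonotope (zvtx c) (zvtx c') ->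
  (#|zsep c c'| <= 1)%N.
Proof.
set u := zvtx c; set v := zvtx c'.
move=> [_ _ _ Fs].
have segu : segment u v u.
  by exists 0; rewrite /= ?lexx ?ler01 // subr0 scale1r scale0r addr0.
have segv : segment u v v.
  by exists 1; rewrite /= ?lexx ?ler01 // subrr scale1r scale0r add0r.
have [e E] := zonotope_face _ _ Fs segu.
have eqs b : segment u v (zvtx b) ->
    forall i, dotp e (g i) != 0 -> (0 < dotp b (g i)) = (0 < dotp e (g i)).
  rewrite E => -[_ /=].
  move/zonotope_max => /(_ (fun i => bool01 _)) H i /H /eqP.
  by rewrite eqr_nat; do 2!case: (0 < _).
have sep0 i : i \in zsep c c' -> dotp e (g i) = 0.
  rewrite inE; case: (eqVneq (dotp e (g i)) 0) => // ei.
  by rewrite (eqs _ segu _ ei) (eqs _ segv _ ei) eqxx.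
apply/card_le1_eqP => j i /sep0 ej /sep0 ei; apply/eqP/negP => /negP ij.
have [r0 _ E0] : segment u v (zvtx e).
  by rewrite E; split; [exact: zvtx_in|exact: dotp_zvtx].
(* Adding [g k] to [zvtx e] stays in the face, hence on the segment, so [g k] is a difference of two
   points of the segment. *)
have addg k : dotp e (g k) = 0 -> exists r, r *: (v - u) = g k.
  move=> ek; pose t l := (0 < dotp e (g l))%R%:R + (l == k)%:R : R.
  have t01 l : 0 <= t l <= 1.
    rewrite /t; case: eqP => [->|_]; last by rewrite addr0 bool01.
    by rewrite ek ltxx add0r ler01 lexx.
  have : segment u v (\sum_i t i *: g i).
    rewrite E; split; first by exists t.
    apply/(zonotope_max _ _ t01) => l el; rewrite /t.
    case: (eqVneq l k) el => [->|_ _]; first by rewrite ek eqxx.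
    by rewrite addr0.
  have -> : \sum_i t i *: g i = zvtx e + g k.
    under eq_bigr do rewrite scalerDl.
    rewrite big_split /=; congr (_ + _).
    rewrite (bigD1 k) //= eqxx scale1r big1 ?addr0 // => l /negPf ->.
    by rewrite scale0r.
  move=> [r _]; rewrite -E0 => Er; exists (r - r0).
  have -> : g k = (1 - r) *: u + r *: v - ((1 - r0) *: u + r0 *: v).
    by rewrite Er addrC addKr.
  by apply/rowP => l; rewrite !mxE; ring.
have [ri Ei] := addg _ ei; have [rj Ej] := addg _ ej.
have [|_ /eqP] := gind i j rj (- ri) ij.
  by rewrite -Ei -Ej !scalerA mulNr scaleNr mulrC subrr.
by rewrite oppr_eq0 => /eqP ri0; have := gn0 i; rewrite -Ei ri0 scale0r eqxx.
Qed.

Lemma zsep_trans c1 c2 c3 : (#|zsep c1 c3| <= #|zsep c1 c2| + #|zsep c2 c3|)%N.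
Proof.
rewrite -cardsUI; apply: leq_trans (leq_addr _ _); apply: subset_leq_card.
by apply/fintype.subsetP => i; rewrite !inE; do 3!case: (0 < _).
Qed.

(** Every vertex on the path comes from a generic functional, and each edge accounts for at most one
    separating generator. *)
Lemma path_zsep c c' (s : seq 'rV[R]_d) : zgeneric c ->
  path (fun x y => `[< Defs.adjacent zonotope x y >]) (zvtx c) s ->
  last (zvtx c) s = zvtx c' -> (#|zsep c c'| <= size s)%N.
Proof.
elim: s c => [|v s IH] c gc /=.
  move=> _ E; rewrite leqn0 cards_eq0; apply/eqP/setP => i.
  by rewrite !inE (zvtx_eq _ _ gc E) eqxx.
move=> /andP[/asboolP cv]; have [_ vv _ _] := cv.
have [c1 gc1 Ev] := vertex_zvtx _ vv; rewrite Ev in cv *.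
move=> /(IH _ gc1) IH1 /IH1 {}IH1; apply: leq_trans (zsep_trans c c1 c') _.
by rewrite -add1n leq_add // adjacent_zsep.
Qed.

(* After a perturbation of c' no two generators have the same ratio
   rho i = - (c'.g_i) / (c.g_i), so the last hyperplane met when moving from c'
   to c, that of the generator maximizing rho, is crossed alone. *)
Lemma zvtx_step c c' : zgeneric c -> zgeneric c' -> zsep c c' != finset.set0 ->
  exists c'', [/\ zgeneric c'', Defs.adjacent zonotope (zvtx c) (zvtx c'') &
    exists2 i, i \in zsep c c' & zsep c'' c' = zsep c c' :\ i].
Proof.
move=> gc gc' /set0Pn[i0 i0D].
(* A functional [c1] is orthogonal to [h (i, j)] exactly when the ratios of [i] and [j] coincide;
   independence makes these vectors nonzero. *)
pose h (ij : I * I) := dotp c (g ij.1) *: g ij.2 - dotp c (g ij.2) *: g ij.1.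
have [|k|c1 c1g c1h] := perturb c' (codom g) [seq h ij | ij <- enum [pred ij | ij.1 != ij.2]].
- by move=> _ /codomP[i ->].
- move=> /mapP[[i j]]; rewrite mem_enum inE /= => ij ->; apply/eqP.
  rewrite /h /= -scaleNr addrC => /(gind _ _ _ _ ij)[_ ci].
  by have := gc i; rewrite ci eqxx.
have c1gp i : (0 < dotp c1 (g i)) = (0 < dotp c' (g i)).
  by apply: mulr_gt0_sign; apply: c1g; apply: codom_f.
have gc1 i : dotp c1 (g i) != 0.
  by have := c1g (g i) (codom_f _ _); case: eqP => // ->; rewrite mulr0 ltxx.
pose rho i := - dotp c1 (g i) / dotp c (g i).
have rho_neq i j : i != j -> rho i != rho j.
  move=> ij; have /c1h : h (i, j) \in [seq h ij | ij <- enum [pred ij | ij.1 != ij.2]].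
    by apply: map_f; rewrite mem_enum.
  apply: contra_neq; rewrite /rho /h /= => /eqP; rewrite eqr_div // => /eqP E.
  rewrite dotpDr -scaleNr !dotpZr; move: E; rewrite !mulNr => /oppr_inj E.
  by rewrite mulrC -E mulrC subrr.
have rho_gt0 i : (0 < rho i) = (i \in zsep c c').
  have := gc i; have := gc1 i; rewrite inE -c1gp /rho.
  case: (ltrgtP 0 (dotp c (g i))) => // p; case: (ltrgtP 0 (dotp c1 (g i))) => // p1 _ _.
  - by apply/negbTE; rewrite -leNgt mulNr oppr_le0 divr_ge0 // ltW.
  - by rewrite divr_gt0 // oppr_gt0.
  - by rewrite mulNr oppr_gt0 pmulr_rlt0 // invr_lt0.
  - apply/negbTE; rewrite -leNgt mulNr oppr_le0 mulr_le0 //; first exact: ltW.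
    by rewrite invr_le0 ltW.
pose i := [arg max_(i > i0) rho i]%O.
have rhoi j : rho j <= rho i by rewrite /i; case: arg_maxP => // k _ /(_ j isT).
have iD : i \in zsep c c' by rewrite -rho_gt0 (lt_le_trans _ (rhoi i0)) // rho_gt0.
(* Up to a positive factor, the point between [c1] and [c] on the hyperplane of [g i]. Since [rho i]
   is the strict maximum, [e] has the sign of [c] on every other generator. *)
pose e := rho i *: c + c1.
have eE j : dotp e (g j) = (rho i - rho j) * dotp c (g j).
  by rewrite dotpDl dotpZl mulrBl /rho divfK // opprK.
have ei : dotp e (g i) = 0 by rewrite eE subrr mul0r.
have ej j : j != i -> (0 < dotp e (g j)) = (0 < dotp c (g j)).
  by move=> ji; rewrite eE pmulr_rgt0 // subr_gt0 lt_neqAle rho_neq //= rhoi.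
have ejn0 j : j != i -> dotp e (g j) != 0.
  move=> ji; rewrite eE mulf_neq0 // subr_eq0 rho_neq // eq_sym //.
have [|del del0 dels] := sign_stable e (- c) [seq g j | j <- enum [pred j | j != i]].
  by move=> k /mapP[j]; rewrite mem_enum inE => ji ->; apply: ejn0.
(* A small step from [e] away from [c] flips the sign at [i] alone. *)
pose c2 := e + del *: - c.
have c2i : dotp c2 (g i) = - (del * dotp c (g i)).
  by rewrite dotpDl ei add0r dotpZl -scaleN1r dotpZl mulN1r mulrN.
have c2j j : j != i -> 0 < dotp e (g j) * dotp c2 (g j).
  by move=> ji; apply: dels; apply: map_f; rewrite mem_enum.
have gc2 : zgeneric c2.
  move=> j; case: (eqVneq j i) => [->|/c2j].
    by rewrite c2i oppr_eq0 mulf_neq0 // gt_eqF.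
  by case: eqP => // ->; rewrite mulr0 ltxx.
have c2jp j : j != i -> (0 < dotp c2 (g j)) = (0 < dotp c (g j)).
  by move=> ji; rewrite -(ej _ ji); apply: mulr_gt0_sign; apply: c2j.
have c2ip : (0 < dotp c2 (g i)) = ~~ (0 < dotp c (g i)).
  rewrite c2i oppr_gt0 pmulr_rlt0 // -leNgt le_eqVlt.
  by rewrite (negPf (gc i)).
have sepE : zsep c2 c' = zsep c c' :\ i.
  apply/setP => j; rewrite !inE; case: (eqVneq j i) => [->|ji] /=; last by rewrite c2jp.
  by move: iD; rewrite inE c2ip; do 2!case: (0 < _).
exists c2; split => //; last by exists i.
split; [exact: zvtx_vertex|exact: zvtx_vertex| |].
  by move=> /(zvtx_eq _ _ gc)/(_ i); rewrite c2ip; case: (0 < _).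
(* On the face exposed by [e] only the coefficient of [g i] is free, so the face is a segment. *)
suff -> : segment (zvtx c) (zvtx c2) = zonotope `&` [set x | dotp e x = zsupp e].
  exact: zsupp_face.
have segE (r : R) : (1 - r) *: zvtx c + r *: zvtx c2 =
    \sum_j ((1 - r) * (0 < dotp c (g j))%R%:R + r * (0 < dotp c2 (g j))%R%:R) *: g j.
  rewrite !scaler_sumr -big_split; apply: eq_bigr => j _ /=.
  by apply/rowP => k; rewrite !mxE; ring.
apply/seteqP; split => x.
- move=> [r /= /andP[r0 r1] <-]; rewrite segE.
  set t := fun j => (1 - r) * (0 < dotp c (g j))%R%:R + r * (0 < dotp c2 (g j))%R%:R.
  have t01 j : 0 <= t j <= 1.
    by rewrite /t; do 2!case: (0 < _); rewrite !(mulr0, mulr1, addr0, add0r); lra.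
  split; first by exists t.
  apply/(zonotope_max _ _ t01) => j; case: (eqVneq j i) => [->|ji _].
    by rewrite ei eqxx.
  by rewrite /t c2jp // ej // -mulrDl subrK mul1r.
- move=> [[t t01 <-]] /(zonotope_max _ _ t01) E.
  (* The free coefficient runs from 1 to 0 along the segment if [c] is positive on [g i], and from 0
     to 1 otherwise. *)
  exists (if 0 < dotp c (g i) then 1 - t i else t i).
    by rewrite /=; have := t01 i; case: ifP => _; lra.
  rewrite segE; apply: eq_bigr => j _; congr (_ *: _).
  case: (eqVneq j i) => [->|ji].
    rewrite c2ip; case: (0 < _) => /=; rewrite !(mulr0, mulr1, addr0, add0r); lra.
  rewrite (E _ (ejn0 _ ji)) ej // c2jp // -mulrDl subrK mul1r //.
Qed.

(** Each step removes one separating generator; once none is left the two vertices coincide. *)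
Lemma zvtx_path c c' : zgeneric c -> zgeneric c' ->
  exists s : seq 'rV[R]_d, [/\ path (fun x y => `[< Defs.adjacent zonotope x y >]) (zvtx c) s,
    last (zvtx c) s = zvtx c' & size s = #|zsep c c'|].
Proof.
move En : #|zsep c c'| => n; elim: n c En => [|n IH] c En gc gc'.
  exists [::]; split => //=; apply: eq_bigr => i _.
  move/eqP: En; rewrite cards_eq0 => /eqP/setP/(_ i).
  by rewrite !inE => /negbFE/eqP ->.
have [|c2 [gc2 adj [i iD sepE]]] := zvtx_step c c' gc gc'.
  by rewrite -cards_eq0 En.
have [|s [ps ls ss]] := IH c2 _ gc2 gc'.
  by apply/eqP; rewrite sepE -eqSS -En [X in _ == X](cardsD1 i) iD.
exists (zvtx c2 :: s) => /=; rewrite ps ls ss andbT; split => //.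
exact/asboolP.
Qed.

(** Upper bound: at most [#|I|] generators separate. Lower bound: the origin [zvtx (- c0)] and the
    sum of all generators [zvtx c0] are separated by every generator. *)
Lemma zonotope_diameter c0 : (forall i, 0 < dotp c0 (g i)) ->
  diameter zonotope = (#|I|%:R)%:E.
Proof.
move=> c0g; apply/eqP; rewrite eq_le; apply/andP; split.
- apply: ge_ereal_sup => _ [[u v] [/= uZ vZ] <-].
  have [c gc ->] := vertex_zvtx _ uZ; have [c' gc' ->] := vertex_zvtx _ vZ.
  have [s [ps ls ss]] := zvtx_path _ _ gc gc'.
  apply: (@le_trans _ _ ((size s)%:R)%:E).
    by apply: ereal_inf_lbound; exists s.
  by rewrite lee_fin ler_nat ss max_card.
- have gc0 : zgeneric c0 by move=> i; rewrite gt_eqF.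
  have N0 i : dotp (- c0) (g i) = - dotp c0 (g i).
    by rewrite -scaleN1r dotpZl mulN1r.
  have gc1 : zgeneric (- c0) by move=> i; rewrite N0 oppr_eq0.
  apply: (@le_trans _ _ (graph_dist zonotope (zvtx (- c0)) (zvtx c0))).
    apply: le_ereal_inf_tmp => _ [s [ps ls] <-]; rewrite lee_fin ler_nat.
    apply: leq_trans (path_zsep _ _ _ gc1 ps ls).
    apply/subset_leq_card/fintype.subsetP => i _; rewrite inE N0 oppr_gt0 c0g.
    by rewrite ltNge ltW.
  apply: ereal_sup_ubound; exists (zvtx (- c0), zvtx c0) => //.
  by split; apply: zvtx_vertex.
Qed.

End Zonotope.

(** * Counting lattice points *)

Section LatticePoints.
Variables (R : realType) (d : nat) (q : R).
Hypothesis q1 : 1 <= q.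
Implicit Types (x y : 'I_d -> nat) (P Q : pred ('I_d -> nat)) (M : nat) (r : R).

Let q_gt0 : 0 < q. Proof. exact: lt_le_trans ltr01 q1. Qed.
Let q_ge0 : 0 <= q. Proof. exact: ltW. Qed.
Let q_neq0 : q != 0. Proof. by rewrite gt_eqF. Qed.

Definition latnorm x : R := (\sum_i (x i)%:R `^ q) `^ q^-1.

Lemma powR_invK (a : R) : 0 <= a -> (a `^ q) `^ q^-1 = a.
Proof. by move=> a0; rewrite -powRrM mulfV // powRr1. Qed.

Lemma powRK_inv (a : R) : 0 <= a -> (a `^ q^-1) `^ q = a.
Proof. by move=> a0; rewrite -powRrM mulVf // powRr1. Qed.

Lemma latnorm_sum_ge0 x : 0 <= \sum_i (x i)%:R `^ q :> R.
Proof. by apply: sumr_ge0 => i _; apply: powR_ge0. Qed.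

Lemma latnorm_ge0 x : 0 <= latnorm x.
Proof. exact: powR_ge0. Qed.

Lemma le_latnorm x y : (forall i, (x i <= y i)%N) -> latnorm x <= latnorm y.
Proof.
move=> xy; apply: ge0_ler_powR; rewrite ?nnegrE ?invr_ge0 ?latnorm_sum_ge0 //.
apply: ler_sum => i _; apply: ge0_ler_powR; rewrite ?nnegrE ?ler0n //.
by rewrite ler_nat.
Qed.

Lemma coord_le_latnorm x i : (x i)%:R <= latnorm x.
Proof.
rewrite -[leLHS]powR_invK ?ler0n //; apply: ge0_ler_powR.
- by rewrite invr_ge0.
- by rewrite nnegrE powR_ge0.
- by rewrite nnegrE latnorm_sum_ge0.
- rewrite (bigD1 i) //= lerDl; apply: sumr_ge0 => j _; exact: powR_ge0.
Qed.

Lemma latnormM (k : nat) x : latnorm (fun i => k * x i)%N = k%:R * latnorm x.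
Proof.
rewrite /latnorm; under eq_bigr do rewrite natrM powRM ?ler0n //.
rewrite -mulr_sumr powRM ?powR_ge0 ?latnorm_sum_ge0 //.
by rewrite powR_invK.
Qed.

Lemma coord_le_trunc x i r : latnorm x <= r -> (x i <= Num.truncn r)%N.
Proof.
move=> xr; have r0 : 0 <= r := le_trans (latnorm_ge0 x) xr.
rewrite -ltnS -(ltr_nat R); apply: le_lt_trans (truncnS_gt r).
exact: le_trans (coord_le_latnorm x i) xr.
Qed.

(** * Counts over finite boxes *)

Definition latcount P M : nat :=
  #|[set x : {ffun 'I_d -> 'I_M.+1} | P (fun i => x i : nat)]%SET|.

(** The map [f] is injective on the points counted, having the left inverse [g] there. The
    comparisons of counts below mostly reduce to this. *)
Lemma latcount_le P Q M M' (f g : ('I_d -> nat) -> ('I_d -> nat)) :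
  (forall x, P x -> (forall i, (x i <= M)%N) ->
    [/\ Q (f x), g (f x) = x & forall i, (f x i <= M')%N]) ->
  (latcount P M <= latcount Q M')%N.
Proof.
move=> H; rewrite /latcount.
pose n (K : nat) (x : {ffun 'I_d -> 'I_K.+1}) : 'I_d -> nat := fun i => x i.
(* [inord] loses nothing here, since [f] maps the counted points into the box of side [M']. *)
pose F (x : {ffun 'I_d -> 'I_M.+1}) : {ffun 'I_d -> 'I_M'.+1} :=
  [ffun i => inord (f (n M x) i)].
have nM (x : {ffun _ -> _}) i : (n M x i <= M)%N by apply: leq_ord.
have nF (x : {ffun _ -> _}) : P (n M x) -> n M' (F x) = f (n M x).
  move=> Px; apply/funext => i; rewrite /n ffunE inordK // ltnS.
  by have [_ _] := H _ Px (nM _); apply.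
rewrite -(card_in_imset (f := F)).
  apply: subset_leq_card; apply/fintype.subsetP => k /imsetP[x].
  rewrite !inE -/(n M x) => Px ->; rewrite -/(n M' (F x)) nF //.
  by have [] := H _ Px (nM _).
move=> x y; rewrite !inE -/(n M x) -/(n M y) => Px Py E.
have [_ gx _] := H _ Px (nM _).
have [_ gy _] := H _ Py (nM _).
have nxy : n M x = n M y by rewrite -gx -gy -!nF // E.
apply/ffunP => i; apply: val_inj.
exact: (congr1 (fun h => h i) nxy).
Qed.

Lemma latcount_box P M M' :
  (forall x, P x -> forall i, (x i <= M)%N && (x i <= M')%N) ->
  latcount P M = latcount P M'.
Proof.
move=> H; apply/eqP; rewrite eqn_leq; apply/andP; split;
  by apply: (latcount_le _ _ _ _ id id) => x Px _; split => // i;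
     have /andP[] := H _ Px i.
Qed.

Definition latball r := latcount (fun x => latnorm x <= r) (Num.truncn r).

(** The gcd of the zero vector is 0, so the origin is not counted. *)
Definition primball r := latcount
  (fun x => (latnorm x <= r) && (\big[gcdn/0%N]_i x i == 1)%N) (Num.truncn r).

Lemma latball_box M r : (Num.truncn r <= M)%N ->
  latball r = latcount (fun x => latnorm x <= r) M.
Proof.
move=> rM; apply: latcount_box => x xr i.
by rewrite coord_le_trunc //= (leq_trans _ rM) // coord_le_trunc.
Qed.

Lemma primball_box M r : (Num.truncn r <= M)%N ->
  primball r = latcount
    (fun x => (latnorm x <= r) && (\big[gcdn/0%N]_i x i == 1)%N) M.
Proof.
move=> rM; apply: latcount_box => x /andP[xr _] i.
by rewrite coord_le_trunc //= (leq_trans _ rM) // coord_le_trunc.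
Qed.

Lemma latball_mono r r' : r <= r' -> (latball r <= latball r')%N.
Proof.
move=> rr'; apply: (latcount_le _ _ _ _ id id) => x xr _; split => //.
  exact: le_trans rr'.
by move=> i; apply: coord_le_trunc; apply: le_trans rr'.
Qed.

Lemma primball_le r : (primball r <= latball r)%N.
Proof.
apply: (latcount_le _ _ _ _ id id) => x /andP[xr _] _; split => //.
by move=> i; apply: coord_le_trunc.
Qed.

Lemma latcount_le_exp P M : (latcount P M <= M.+1 ^ d)%N.
Proof.
apply: leq_trans (max_card _) _.
by rewrite card_ffun !card_ord.
Qed.

Lemma latball_le_exp r : 0 <= r -> (latball r)%:R <= (r + 1) ^+ d.
Proof.
move=> r0; apply: (@le_trans _ _ ((Num.truncn r).+1 ^ d)%:R).
  by rewrite ler_nat latcount_le_exp.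
rewrite natrX lerXn2r ?nnegrE ?ler0n ?addr_ge0 //.
by rewrite -natr1 lerD2r truncn_le.
Qed.

(* Division with remainder by n, coordinatewise. *)
Lemma latball_scale (n : nat) r : (0 < n)%N -> 0 <= r ->
  (latball (n%:R * r) <= n ^ d * latball r)%N.
Proof.
move=> n0 r0; case: n n0 => // n _.
set M := Num.truncn (n.+1%:R * r).
have -> : latball r = latcount (fun x => latnorm x <= r) M.
  by apply: latball_box; apply: le_truncn; rewrite ler_peMl // ler1n.
rewrite mulnC -[X in (_ * X ^ d)%N]card_ord -[X in (_ * _ ^ X)%N]card_ord -card_ffun.
rewrite -cardsT -cardsX.
pose F (x : {ffun 'I_d -> 'I_M.+1}) : {ffun 'I_d -> 'I_M.+1} * {ffun 'I_d -> 'I_n.+1} :=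
  ([ffun i => inord (x i %/ n.+1)], [ffun i => inord (x i %% n.+1)]).
have divK (x : 'I_M.+1) : (x %/ n.+1 < M.+1)%N.
  by apply: leq_ltn_trans (ltn_ord x); apply: leq_div.
rewrite /latball /latcount -(card_imset _ (f := F)).
  apply: subset_leq_card; apply/fintype.subsetP => k /imsetP[x].
  (* The quotient lies in the ball of radius [r], since [n.+1] times it is coordinatewise at most
     [x]. *)
  rewrite !inE /= => xr ->; rewrite andbT -(@ler_pM2l _ n.+1%:R) ?ltr0n //.
  rewrite -latnormM; apply: le_trans xr; apply: le_latnorm => i.
  by rewrite ffunE inordK // mulnC leq_trunc_div.
move=> x y [/ffunP E1 /ffunP E2]; apply/ffunP => i; apply: val_inj => /=.
have := congr1 val (E1 i); have := congr1 val (E2 i); rewrite !ffunE /= !inordK ?ltn_pmod //.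
by move=> m1 m2; rewrite (divn_eq (x i) n.+1) m1 m2 -divn_eq.
Qed.

Lemma primball_lt1 r : r < 1 -> primball r = 0%N.
Proof.
move=> r1; apply/eqP; rewrite cards_eq0; apply/eqP/setP => x; rewrite !inE.
apply/negbTE; apply/negP => /andP[xr]; rewrite big1 // => i _.
apply/eqP; rewrite -leqn0 -ltnS -(ltr_nat R).
apply: le_lt_trans r1; apply: le_trans xr.
exact: (coord_le_latnorm (fun i => x i : nat)).
Qed.

Lemma gcd_coord (x : 'I_d -> nat) i : (\big[gcdn/0%N]_i x i %| x i)%N.
Proof. by rewrite (bigD1 i) //= dvdn_gcdl. Qed.

Lemma gcd_coordM (k : nat) x :
  (\big[gcdn/0%N]_i (k * x i) = k * \big[gcdn/0%N]_i x i)%N.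
Proof.
elim/big_rec2: _ => [|i y1 y2 _ ->]; first by rewrite muln0.
by rewrite muln_gcdr.
Qed.

(** The points are sorted by the gcd of their coordinates: gcd 0 is the origin, and the points of
    gcd [k] are [k] times the primitive points of the ball of radius [r / k]. *)
Lemma latball_gcd r (K : nat) : 0 <= r -> (Num.truncn r <= K)%N ->
  latball r = (1 + \sum_(1 <= k < K.+1) primball (r / k%:R))%N.
Proof.
move=> r0 rK; rewrite (latball_box K) // /latcount -sum1_card.
pose G (x : {ffun 'I_d -> 'I_K.+1}) : nat := \big[gcdn/0%N]_i x i.
(* The gcd divides some nonzero coordinate, if there is one, so it indexes a class in ['I_K.+1]. *)
have GK (x : {ffun 'I_d -> 'I_K.+1}) : (G x < K.+1)%N.
  rewrite ltnS; have [/existsP[i xi]|/existsPn x0] := boolP [exists i, (0 < x i)%N].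
    apply: leq_trans (leq_ord (x i)); apply: dvdn_leq => //.
    exact: (gcd_coord (fun i => x i : nat)).
  rewrite /G big1 // => i _; apply/eqP; rewrite -leqn0 leqNgt; exact: x0.
rewrite (partition_big (fun x : {ffun 'I_d -> 'I_K.+1} => inord (G x) : 'I_K.+1) xpredT) //=.
rewrite big_ord_recl /=; congr (_ + _)%N.
  rewrite sum1dep_card; apply/eqP/cards1P; exists [ffun=> ord0].
  apply/setP => x; rewrite !inE -val_eqE /= inordK //.
  apply/andP/eqP => [[_ Gx]|->].
    apply/ffunP => i; apply: val_inj; rewrite ffunE /=; apply/eqP.
    by have := gcd_coord (fun i => x i : nat) i; rewrite -/(G x) (eqP Gx) dvd0n.
  split; last by rewrite /G big1 // => i _; rewrite ffunE.
  rewrite /latnorm big1 ?powR0 ?invr_eq0 // => i _.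
  by rewrite ffunE powR0.
rewrite big_add1 big_mkord; apply: eq_bigr => k _.
have k0 : 0 < (lift ord0 k : nat)%:R :> R by rewrite ltr0n.
rewrite sum1dep_card (primball_box K); last first.
  apply: leq_trans rK; apply: le_truncn.
  by rewrite ler_pdivrMr // ler_peMr // ler1n.
transitivity (latcount (fun x => (latnorm x <= r) && (\big[gcdn/0%N]_i x i == k.+1)) K).
  apply: eq_card => x; rewrite !inE; congr (_ && _).
  by rewrite -val_eqE /= inordK.
apply/eqP; rewrite eqn_leq; apply/andP; split.
- apply: (latcount_le _ _ _ _ (fun x i => x i %/ k.+1)%N (fun x i => k.+1 * x i)%N).
  move=> x /andP[xr /eqP Gx] xK.
  have E : (fun i => k.+1 * (x i %/ k.+1))%N = x.
    by apply/funext => i; rewrite mulnC divnK // -Gx gcd_coord.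
  split => //; last by move=> i; apply: leq_trans (xK i); apply: leq_div.
  apply/andP; split.
    by rewrite ler_pdivlMr // mulrC -latnormM E.
  rewrite -(eqn_pmul2l (ltn0Sn k)) -gcd_coordM muln1 -[X in _ == X]Gx.
  by apply/eqP; apply: eq_bigr => i _; rewrite mulnC divnK // -Gx gcd_coord.
- apply: (latcount_le _ _ _ _ (fun x i => k.+1 * x i)%N (fun x i => x i %/ k.+1)%N).
  move=> x /andP[xr /eqP Gx] xK; have xr' : latnorm (fun i => k.+1 * x i)%N <= r.
    by rewrite latnormM mulrC -ler_pdivlMr.
  split; first by rewrite xr' gcd_coordM Gx muln1 /=.
    by apply/funext => i; rewrite mulKn.
  by move=> i; apply: leq_trans rK; apply: (coord_le_trunc (fun i => k.+1 * x i)%N).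
Qed.

(** * Asymptotic density of lattice points *)

(** The volume of the positive part of the unit ball, taken as an infimum of densities so that no
    measure in dimension [d] enters. *)
Definition latvol : R := inf [set (latball r)%:R / r ^+ d | r in [set r : R | 0 < r]].

Lemma latvol_lbound :
  has_inf [set (latball r)%:R / r ^+ d | r in [set r : R | 0 < r]].
Proof.
split; first by exists ((latball 1)%:R / 1 ^+ d); exists 1; rewrite //= ltr01.
by exists 0 => _ [r r0 <-]; rewrite divr_ge0 ?ler0n ?exprn_ge0 ?ltW.
Qed.

Lemma latvol_le r : 0 < r -> latvol <= (latball r)%:R / r ^+ d.
Proof. by move=> r0; apply: ge_inf; [exact: latvol_lbound.2|exists r]. Qed.

Lemma latvol_ge0 : 0 <= latvol.
Proof.
apply: lb_le_inf; first exact: latvol_lbound.1.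
by move=> _ [r r0 <-]; rewrite divr_ge0 ?ler0n ?exprn_ge0 ?ltW.
Qed.

(* By latball_scale the density at a large radius is at most that at r0, up to
   rounding the radius to a multiple of r0. *)
Lemma latball_cvg : (latball r)%:R / r ^+ d @[r --> +oo] --> latvol.
Proof.
apply/cvgrPdist_lt => e e0.
have [_ [r0 /= r00 <-] r0e] := inf_adherent e0 latvol_lbound.
set f0 := _ / _ in r0e.
have cvg0 : (1 + r0 / r) ^+ d * f0 @[r --> +oo] --> f0.
  rewrite -[X in _ --> X]mul1r; apply: cvgMl.
  rewrite -[X in _ --> X](expr1n _ d).
  suff c1 : 1 + r0 / r @[r --> +oo] --> (1 : R).
    exact: (cvg_comp _ _ c1 (@exprn_continuous R d 1)).
  rewrite -[X in _ --> X]addr0; apply: cvgD; first exact: cvg_cst.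
  rewrite -(mulr0 r0); apply: cvgMr.
  by apply/gtr0_cvgV0; [exact: nbhs_pinfty_gt|exact: cvg_id].
near=> r.
have r_gt0 : 0 < r by near: r; exact: nbhs_pinfty_gt.
rewrite distrC ger0_norm ?subr_ge0 ?latvol_le // ltrBlDr addrC.
apply: le_lt_trans (_ : (1 + r0 / r) ^+ d * f0 < _); last first.
  by near: r; apply: cvgr_lt cvg0 _ _.
(* This [n] gives [r <= n * r0 <= r + r0], so rounding costs at most the factor [(1 + r0 / r) ^ d],
   which tends to 1. *)
set n := (Num.truncn (r / r0)).+1.
have rn : r <= n%:R * r0 by rewrite -ler_pdivrMr // ltW // truncnS_gt.
have nr : n%:R * r0 <= r + r0.
  rewrite -natr1 mulrDl mul1r lerD2r -ler_pdivlMr // truncn_le.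
  by rewrite divr_ge0 // ltW.
rewrite ler_pdivrMr ?exprn_gt0 //.
apply: (@le_trans _ _ ((n%:R) ^+ d * (latball r0)%:R)).
  rewrite -natrX -natrM ler_nat; apply: leq_trans (latball_mono _ _ rn) _.
  by rewrite latball_scale // ltW.
have -> : (1 + r0 / r) ^+ d * f0 * r ^+ d = ((r + r0) / r0) ^+ d * (latball r0)%:R.
  rewrite /f0 expr_div_n mulrAC -exprMn mulrDl mul1r divfK ?gt_eqF //.
  by rewrite mulrA mulrAC.
rewrite ler_wpM2r ?ler0n // lerXn2r ?nnegrE ?ler0n //.
  by rewrite divr_ge0 ?addr_ge0 // ltW.
by rewrite ler_pdivlMr.
Unshelve. all: by end_near. Qed.

End LatticePoints.

(** * Density of primitive points *)

Section PrimitiveDensity.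
Variable R : realType.

(** Telescoping, from [k^-d <= k^-2 <= 1/(k-1) - 1/k]. *)
Lemma sum_inv_exp_tail (d m K : nat) : (2 <= d)%N -> (0 < m)%N -> (m <= K)%N ->
  \sum_(m.+1 <= k < K.+1) (k%:R ^+ d)^-1 <= m%:R^-1 - K%:R^-1 :> R.
Proof.
move=> d2 m0; elim: K => [|K IH]; first by rewrite leqn0 => /eqP m00; rewrite m00 in m0.
rewrite leq_eqVlt => /predU1P[<-|]; first by rewrite big_geq // subrr.
rewrite ltnS => mK; rewrite big_nat_recr //=.
have K0 : 0 < K%:R :> R by rewrite ltr0n (leq_trans m0).
have K10 : 0 < K.+1%:R :> R by rewrite ltr0n.
suff : (K.+1%:R ^+ d)^-1 <= K%:R^-1 - K.+1%:R^-1 :> R.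
  by move=> /(lerD (IH mK)); rewrite addrA subrK.
apply: (@le_trans _ _ (K.+1%:R ^+ 2)^-1).
  by rewrite lef_pV2 ?posrE ?exprn_gt0 // ler_weXn2l // ler1n.
have -> : K%:R^-1 - K.+1%:R^-1 = (K%:R * K.+1%:R)^-1 :> R.
  by rewrite -natr1; field; rewrite natr1 !gt_eqF.
by rewrite lef_pV2 ?posrE ?exprn_gt0 ?mulr_gt0 // expr2 ler_pM2r // ler_nat.
Qed.

(** The term [k = 2] is at most 1/4 and the terms beyond it sum to at most 1/2. What matters later
    is that 3/4 is below 1. *)
Lemma sum_inv_exp_ge2 (d K : nat) : (2 <= d)%N ->
  \sum_(2 <= k < K.+1) (k%:R ^+ d)^-1 <= 3 / 4 :> R.
Proof.
move=> d2; case: K => [|[|K]]; try by rewrite big_geq // divr_ge0.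
rewrite big_ltn //=.
have : (2 ^+ d)^-1 <= 1 / 4 :> R.
  rewrite div1r lef_pV2 ?posrE ?exprn_gt0 //.
  by rewrite (_ : 4 = 2 ^+ 2) ?ler_weXn2l ?ler1n //; ring.
have := sum_inv_exp_tail d 2 K.+2 d2 isT isT.
have : 0 < K.+2%:R^-1 :> R by rewrite invr_gt0 ltr0n.
set a := K.+2%:R^-1; set b := \sum_(_ <= _ < _) _; set c := 2 ^- d; lra.
Qed.

Lemma zeta_series (d n : nat) :
  series (fun n : nat => (n.+1%:R : R) `^ (- d%:R)) n =
  \sum_(1 <= k < n.+1) (k%:R ^+ d)^-1.
Proof.
rewrite /series /= big_add1 /=; apply: eq_bigr => k _.
by rewrite powRN powR_mulrn ?ler0n.
Qed.

Lemma zeta_cvg (d : nat) : (2 <= d)%N ->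
  \sum_(1 <= k < n.+1) (k%:R ^+ d)^-1 @[n --> \oo] --> zeta (d%:R : R).
Proof.
move=> d2; rewrite /zeta.
under [X in X @ _]eq_fun do rewrite -zeta_series.
apply: nondecreasing_is_cvgn.
  apply/nondecreasing_seqP => n; rewrite /series /= big_nat_recr //= lerDl.
  exact: powR_ge0.
exists (1 + 3 / 4) => _ [n _ <-]; rewrite zeta_series.
case: n => [|n]; first by rewrite big_geq // addr_ge0 // divr_ge0.
by rewrite big_ltn // expr1n invr1 lerD2l sum_inv_exp_ge2.
Qed.

Lemma zeta_gt0 (d : nat) : (2 <= d)%N -> 0 < zeta (d%:R : R).
Proof.
move=> d2; apply: (lt_le_trans ltr01).
apply: (cvgr_to_ge (zeta_cvg d d2)); near=> n.
have n0 : (0 < n)%N by near: n; exact: nbhs_infty_gt.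
rewrite big_ltn // expr1n invr1 lerDl; apply: sumr_ge0 => k _.
by rewrite invr_ge0 exprn_ge0.
Unshelve. all: by end_near. Qed.

(* Since zeta(d) - 1 <= 3/4, the recursion contracts the limsup of |e|. *)
Lemma dirichlet_recursion_cvg0 (d : nat) (e G : R -> R) (B : R) : (2 <= d)%N ->
  (forall p, 0 < p -> `|e p| <= B) ->
  (forall p, 1 <= p -> e p = G p -
    \sum_(2 <= k < (Num.truncn p).+1) (k%:R ^+ d)^-1 * e (p / k%:R)) ->
  G p @[p --> +oo] --> 0 -> e p @[p --> +oo] --> 0.
Proof.
move=> d2 eB eE G0.
have B0 : 0 <= B by apply: le_trans (eB 1 ltr01).
(* The factor 7/8 is 3/4 from the terms [k <= m], plus 1/16 from the terms [k > m], plus 1/16 from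
   [G]. *)
have step (A : R) : 0 < A -> (\forall p \near +oo, `|e p| <= A) ->
    \forall p \near +oo, `|e p| <= 7 / 8 * A.
  move=> A0 [P0 [_ eA]]; pose P := Num.max P0 1.
  have P1 : 1 <= P by rewrite le_max lexx orbT.
  have {}eA p : P < p -> `|e p| <= A by rewrite gt_max => /andP[/eA].
  (* Beyond [m] only the global bound [B] is used; this choice makes that tail at most
     [B / m <= A / 16]. *)
  pose m := (Num.truncn (16 * B / A)).+1.
  have m0 : 0 < m%:R :> R by rewrite ltr0n.
  have Bm : B / m%:R <= A / 16.
    rewrite ler_pdivrMr //; have : 16 * B / A <= m%:R by rewrite ltW // truncnS_gt.
    rewrite ler_pdivrMr //; lra.
  near=> p.
  (* This puts [p / k] beyond [P] for every [k <= m], where the bound [A] applies. *)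
  have pm : P * m%:R < p by near: p; apply: nbhs_pinfty_gt; rewrite num_real.
  have p_m : m%:R < p by apply: le_lt_trans pm; rewrite ler_peMl // ltW.
  have p1 : 1 <= p by apply: le_trans (ltW p_m); rewrite ler1n.
  have p0 : 0 < p by apply: lt_le_trans p1.
  have mK : (m <= Num.truncn p)%N.
    by rewrite -ltnS -(ltr_nat R); apply: lt_trans p_m (truncnS_gt p).
  have Gp : `|G p| <= A / 16.
    by near: p; move/cvgr0Pnorm_le : G0; apply; rewrite divr_gt0.
  rewrite eE //; apply: le_trans (ler_normB _ _) _.
  suff : `|\sum_(2 <= k < (Num.truncn p).+1) (k%:R ^+ d)^-1 * e (p / k%:R)|
     <= 3 / 4 * A + A / 16 by lra.
  apply: le_trans (ler_norm_sum _ _ _) _.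
  rewrite (big_cat_nat (n := m.+1)) //=; apply: lerD.
  - apply: (@le_trans _ _ (\sum_(2 <= k < m.+1) (k%:R ^+ d)^-1 * A)).
      rewrite big_nat [leRHS]big_nat; apply: ler_sum => k /andP[k2 km].
      have k0 : 0 < k%:R :> R by rewrite ltr0n (leq_trans _ k2).
      rewrite normrM ger0_norm ?invr_ge0 ?exprn_ge0 ?ler0n //.
      rewrite ler_wpM2l ?invr_ge0 ?exprn_ge0 ?ler0n //; apply: eA.
      rewrite ltr_pdivlMr //; apply: le_lt_trans pm.
      by rewrite ler_pM2l ?ler_nat // (lt_le_trans ltr01).
    by rewrite -mulr_suml ler_pM2r // sum_inv_exp_ge2.
  - apply: (@le_trans _ _ (\sum_(m.+1 <= k < (Num.truncn p).+1) (k%:R ^+ d)^-1 * B)).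
      rewrite big_nat [leRHS]big_nat; apply: ler_sum => k /andP[km _].
      have k0 : 0 < k%:R :> R by rewrite ltr0n (leq_trans _ km).
      rewrite normrM ger0_norm ?invr_ge0 ?exprn_ge0 ?ler0n //.
      rewrite ler_wpM2l ?invr_ge0 ?exprn_ge0 ?ler0n //; apply: eB.
      by rewrite divr_gt0.
    rewrite -mulr_suml; apply: le_trans Bm; rewrite mulrC ler_wpM2l //.
    apply: le_trans (sum_inv_exp_tail _ _ _ d2 _ mK) _ => //.
    by rewrite gerBl invr_ge0 ler0n.
(* Starting from [B + 1] rather than [B] keeps the bound positive, as [step] demands. *)
have iter n : \forall p \near +oo, `|e p| <= (7 / 8) ^+ n * (B + 1).
  elim: n => [|n IH].
    near=> p; rewrite expr0 mul1r; apply: le_trans (eB _ _) _; last by rewrite lerDl.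
    by near: p; apply: nbhs_pinfty_gt; rewrite num_real.
  rewrite exprS -mulrA; apply: step => //.
  by rewrite mulr_gt0 ?exprn_gt0 ?divr_gt0 // ltr_wpDl.
apply/cvgr0Pnorm_le => eps eps0.
have c0 : (7 / 8) ^+ n * (B + 1) @[n --> \oo] --> (0 : R).
  rewrite -(mul0r (B + 1)); apply: cvgMl; apply: cvg_expr.
  by rewrite ger0_norm ?divr_ge0 // ltr_pdivrMr //; lra.
have [n _ nE] := cvgr_lt _ c0 _ eps0.
apply: filterS (iter n) => p /le_trans; apply; apply: ltW.
exact: nE n (leqnn n).
Unshelve. all: by end_near. Qed.

(** * Limit of the primitive density *)

Variables (d : nat) (q : R).
Hypotheses (q1 : 1 <= q) (d2 : (2 <= d)%N).

(** Below radius 1 nothing is counted, and from there on [p + 1 <= 2 * p]. This supplies the global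
    bound for the recursion. *)
Lemma primball_density_bound (p : R) : 0 < p ->
  0 <= (primball R d q p)%:R / p ^+ d <= 2 ^+ d.
Proof.
move=> p0; rewrite divr_ge0 ?exprn_ge0 ?ler0n ?(ltW p0) //=.
have [p1|p1] := ltP p 1; first by rewrite primball_lt1 // mul0r exprn_ge0.
rewrite ler_pdivrMr ?exprn_gt0 // -exprMn.
apply: (@le_trans _ _ (latball R d q p)%:R); first by rewrite ler_nat primball_le.
apply: le_trans (latball_le_exp _ _ _ _ (ltW p0)) _.
by rewrite lerXn2r ?nnegrE //; lra.
Qed.

Lemma primball_cvg :
  (primball R d q p)%:R / p ^+ d @[p --> +oo] --> latvol R d q / zeta (d%:R : R).
Proof.
set W := _ / _.
have z0 := zeta_gt0 d d2.
have W0 : 0 <= W by rewrite divr_ge0 ?latvol_ge0 ?ltW.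
pose h (p : R) := (primball R d q p)%:R / p ^+ d.
pose Z n : R := \sum_(1 <= k < n.+1) (k%:R ^+ d)^-1.
(* Dividing the gcd decomposition by [p ^ d] and subtracting [W] times the zeta sum leaves this as
   inhomogeneous term; it tends to [latvol - W * zeta d = 0]. *)
pose G (p : R) := (latball R d q p)%:R / p ^+ d - (p ^+ d)^-1 - W * Z (Num.truncn p).
suff e0 : h p - W @[p --> +oo] --> 0.
  exact/subr_cvg0.
apply: (dirichlet_recursion_cvg0 d _ G (2 ^+ d + W) d2).
- move=> p p0; have /andP[h0 h2] := primball_density_bound p p0.
  apply: le_trans (ler_normB _ _) _; rewrite !ger0_norm //; exact: lerD.
- move=> p p1; have p0 : 0 < p by apply: lt_le_trans p1.
  have K1 : (0 < Num.truncn p)%N.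
    by rewrite -ltnS -(ltr_nat R); apply: le_lt_trans p1 (truncnS_gt p).
  have := latball_gcd R d q q1 p _ (ltW p0) (leqnn _).
  move=> /(congr1 (fun n : nat => n%:R / p ^+ d : R)).
  rewrite natrD natr_sum mulrDl mul1r => E.
  have E2 : \sum_(1 <= k < (Num.truncn p).+1) (k%:R ^+ d)^-1 * h (p / k%:R) =
      (latball R d q p)%:R / p ^+ d - (p ^+ d)^-1.
    rewrite E addrC addKr mulr_suml big_nat [RHS]big_nat; apply: eq_bigr => k /andP[k1 _].
    have k0 : k%:R != 0 :> R by rewrite pnatr_eq0 -lt0n.
    rewrite /h expr_div_n invf_div mulrCA mulrA mulrA [X in X * _]mulrC; congr (_ / _).
    by rewrite mulrC divfK // expf_neq0.
  rewrite /G -E2 /Z -mulrC mulr_suml -sumrB.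
  under eq_bigr do rewrite -mulrBr.
  by rewrite big_ltn //= expr1n !invr1 mul1r mulr1 addrK.
- have -> : 0 = latvol R d q - 0 - W * zeta (d%:R : R).
    by rewrite /W divfK ?gt_eqF // subr0 subrr.
  apply: cvgB; [apply: cvgB|].
  + exact: latball_cvg.
  + apply/gtr0_cvgV0.
      by near=> p; rewrite exprn_gt0 //; near: p; apply: nbhs_pinfty_gt; rewrite num_real.
    apply/cvgryPge => A; near=> p.
    have p1 : 1 <= p by near: p; apply: nbhs_pinfty_ge; rewrite num_real.
    apply: (@le_trans _ _ p); first by near: p; apply: nbhs_pinfty_ge; rewrite num_real.
    by rewrite -[leLHS]expr1 ler_weXn2l // (leq_trans _ d2).
  + apply: cvgMr; apply: (cvg_comp _ _ _ (zeta_cvg d d2)).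
    apply/cvgnyPge => N; near=> p; rewrite -ltnS -(ltr_nat R).
    apply: le_lt_trans (truncnS_gt p).
    by near: p; apply: nbhs_pinfty_ge; rewrite num_real.
Unshelve. all: by end_near. Qed.

End PrimitiveDensity.

(** * Gamma integrals *)

Section GammaIntegral.
Variables (R : realType).
Local Notation mu := (@lebesgue_measure R).
Local Notation D := (`]0, +oo[%classic : set R).

Lemma measurable_expRN (A : set R) : measurable_fun A (fun t : R => expR (- t)).
Proof. by apply: measurableT_comp => //; exact: measurable_oppr. Qed.

Lemma measurable_step (A : set R) (a : R) : measurable_fun A (fun t : R => (a <= t)%R%:R : R).
Proof.
have -> : (fun t : R => (a <= t)%R%:R : R) = \1_(`[a, +oo[%classic).
  by apply/funext => t; rewrite indicE mem_setE in_itv /= andbT.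
exact: measurable_indic.
Qed.

Lemma integral_expRN_itv (a : R) :
  (\int[mu]_(t in `[a, +oo[) (expR (- t))%:E = (expR (- a))%:E)%E.
Proof.
have dF (x : R) : is_derive x 1 (fun t : R => - expR (- t)) (expR (- x)).
  by apply: is_derive_eq; rewrite mulrN1 opprK.
have cexp : continuous (fun t : R => expR (- t)).
  move=> x; apply: (@continuous_comp _ _ _ (fun t : R => - t) expR).
    exact: continuousN.
  exact: continuous_expR.
rewrite (@ge0_continuous_FTC2y _ (fun t => expR (- t)) (fun t => - expR (- t)) _ 0).
- by rewrite sub0e -EFinN opprK.
- by move=> x _; exact: expR_ge0.
- exact: continuous_subspaceT.
- rewrite -oppr0; apply: cvgN; exact: cvgr_expR.
- by move=> x _; have [] := dF x.
- by apply: cvg_at_right_filter; apply: cvgN; apply: cexp.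
- by move=> x _; rewrite derive1E; have [_ ->] := dF x.
Qed.

(** Writes [exp(-a)] as an integral of indicators of [a <= t], which turns a sum of exponentials
    into counts of lattice points in balls. *)
Lemma integral_expRN_step (a : R) : 0 <= a ->
  (\int[mu]_(t in D) (expR (- t) * (a <= t)%R%:R)%:E = (expR (- a))%:E)%E.
Proof.
move=> a0; rewrite integral_itv_obnd_cbnd; last first.
  apply/measurable_EFinP; apply: measurable_funM; first exact: measurable_expRN.
  exact: measurable_step.
rewrite -integral_expRN_itv integral_mkcond [RHS]integral_mkcond.
apply: eq_integral => t _; rewrite !patchE !mem_setE !in_itv /= !andbT.
have [at_|at_] := leP a t; first by rewrite (le_trans a0 at_) mulr1.
by case: ifP; rewrite // mulr0.
Qed.

(** The dominating function for all integrals below, a multiple of the exponential density of rate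
    1/2. *)
Definition expdom (d : nat) (t : R) : R := (2 * d%:R) ^+ d * expR (- (t / 2)).

Lemma expdom_integrable (d : nat) : mu.-integrable D (EFin \o expdom d).
Proof.
have h0 : 0 < 2^-1 :> R by rewrite invr_gt0.
have iT : mu.-integrable setT (EFin \o exponential_pdf (2^-1 : R)).
  exact: integrable_exponential_pdf.
have iD : mu.-integrable D (EFin \o exponential_pdf (2^-1 : R)).
  exact: integrableS iT.
have : mu.-integrable D
    (fun t => (((2 * d%:R) ^+ d * 2)%:E * (EFin \o exponential_pdf (2^-1 : R)) t)%E).
  exact: integrableZl.
apply: eq_integrable => //; move=> t; rewrite inE /= in_itv /= andbT => t0.
rewrite exponential_pdfE ?(ltW t0) // -EFinM /expdom; congr (_%:E).
rewrite -mulrA [2 * (_ * _)]mulrA mulfV // mul1r; congr (_ * expR _).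
by rewrite mulrC mulrN.
Qed.

(** From [t^(1/q) <= t + 1] the base is at most [2d + t], hence at most [2d * exp(t / (2d))]; its
    [d]-th power costs only [exp(t/2)]. *)
Lemma powR_le_expdom (d : nat) (q t : R) : (0 < d)%N -> 1 <= q -> 0 < t ->
  expR (- t) * (t `^ q^-1 + 1) ^+ d <= expdom d t.
Proof.
move=> d0 q1 t0; have q0 : 0 < q by apply: lt_le_trans q1.
have dR : 0 < d%:R :> R by rewrite ltr0n.
have tq : t `^ q^-1 <= t + 1.
  have [t1|t1] := leP t 1.
    apply: (@le_trans _ _ 1); last by rewrite lerDr ltW.
    have -> : 1 = 1 `^ q^-1 :> R by rewrite powR1.
    apply: ge0_ler_powR; rewrite ?nnegrE ?invr_ge0 //; exact: ltW.
  apply: (@le_trans _ _ t); last by rewrite lerDl.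
  rewrite -[leRHS]powRr1 ?(ltW t0) //; apply: ler_powR; first exact: ltW.
  by rewrite invf_le1.
have base : t `^ q^-1 + 1 <= 2 * d%:R * expR (t / (2 * d%:R)).
  apply: (@le_trans _ _ (2 * d%:R * (1 + t / (2 * d%:R)))); last first.
    by rewrite ler_pM2l ?mulr_gt0 // expR_ge1Dx.
  rewrite mulrDr mulr1 mulrC mulrCA mulfV ?mulr1 ?gt_eqF ?mulr_gt0 //.
  have : 1 <= d%:R :> R by rewrite ler1n.
  by move: tq; set u := t `^ _; lra.
rewrite /expdom; have -> : - (t / 2) = - t + t / 2 by lra.
rewrite expRD mulrCA ler_pM2l ?expR_gt0 //.
have -> : expR (t / 2) = expR (t / (2 * d%:R)) ^+ d.
  by rewrite -expRM_natl; congr expR; field; rewrite gt_eqF.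
by rewrite -exprMn lerXn2r ?nnegrE ?addr_ge0 ?powR_ge0.
Qed.

Lemma powR_divn (d : nat) (q t : R) : 0 <= t -> t `^ (d%:R / q) = (t `^ q^-1) ^+ d.
Proof. by move=> t0; rewrite mulrC powRrM powR_mulrn // powR_ge0. Qed.

Lemma measurable_gammaf (A : set R) (s : R) :
  measurable_fun A (fun t : R => t `^ s * expR (- t)).
Proof.
apply: measurable_funM; last exact: measurable_expRN.
apply: measurable_funS (measurable_powR s) => //.
Qed.

Lemma gammaf_integrable (d : nat) (q : R) : (0 < d)%N -> 1 <= q ->
  mu.-integrable D (fun t : R => (t `^ (d%:R / q) * expR (- t))%:E).
Proof.
move=> d0 q1; apply: le_integrable (expdom_integrable d) => //.
  by apply/measurable_EFinP; exact: measurable_gammaf.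
move=> t; rewrite /= in_itv /= andbT => t0.
rewrite !lee_fin ger0_norm ?mulr_ge0 ?powR_ge0 ?expR_ge0 //.
rewrite (le_trans _ (ler_norm _)) // (le_trans _ (powR_le_expdom d q t d0 q1 t0)) //.
rewrite powR_divn ?(ltW t0) // mulrC ler_pM2l ?expR_gt0 //.
by rewrite lerXn2r ?nnegrE ?addr_ge0 ?powR_ge0 // lerDl.
Qed.

Lemma GammaE (d : nat) (q : R) : (0 < d)%N -> 1 <= q ->
  (\int[mu]_(t in D) (t `^ (d%:R / q) * expR (- t))%:E = (Gamma (d%:R / q + 1))%:E)%E.
Proof.
move=> d0 q1; rewrite /Gamma /Rintegral addrK fineK //.
exact: integrable_fin_num (gammaf_integrable d q d0 q1).
Qed.

(** For [t >= 1] the integrand is at least [exp(-t)], so the integral is at least [exp(-1)]. *)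
Lemma Gamma_gt0 (d : nat) (q : R) : (0 < d)%N -> 1 <= q ->
  0 < Gamma (d%:R / q + 1).
Proof.
move=> d0 q1; rewrite -lte_fin -GammaE //.
apply: (@lt_le_trans _ _ (expR (- 1))%:E); first by rewrite lte_fin expR_gt0.
rewrite -integral_expRN_step //; apply: ge0_le_integral => //.
- apply/measurable_EFinP; apply: measurable_funM; first exact: measurable_expRN.
  exact: measurable_step.
- by apply/measurable_EFinP; exact: measurable_gammaf.
- move=> t _; rewrite lee_fin mulrC ler_pM2r ?expR_gt0 //.
  have [t1|_] := leP 1 t; last exact: powR_ge0.
  rewrite -[leLHS](powRr0 t); apply: ler_powR => //.
  by rewrite divr_ge0 // (le_trans _ q1).
Qed.

End GammaIntegral.

(** * The volume constant *)

Section LatticeVolume.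
Variables (R : realType) (q : R).
Hypothesis q1 : 1 <= q.
Local Notation mu := (@lebesgue_measure R).
Local Notation D := (`]0, +oo[%classic : set R).

Let q_gt0 : 0 < q. Proof. exact: lt_le_trans ltr01 q1. Qed.
Let qV_ge0 : 0 <= q^-1. Proof. by rewrite invr_ge0 ltW. Qed.

Lemma ler_powR_inv (a b : R) : 0 <= a -> 0 <= b ->
  (a `^ q^-1 <= b `^ q^-1) = (a <= b).
Proof.
move=> a0 b0; apply/idP/idP => ab; last by apply: ge0_ler_powR; rewrite ?nnegrE.
rewrite -[leLHS](powRK_inv R q q1 a a0) -[leRHS](powRK_inv R q q1 b b0).
by apply: ge0_ler_powR; rewrite ?nnegrE ?powR_ge0 // ltW.
Qed.

Variable d : nat.
Implicit Types (x : 'I_d -> nat) (n : nat).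

Definition scaledsum n x : R := \sum_i ((x i)%:R / n%:R) `^ q.

Lemma scaledsum_ge0 n x : 0 <= scaledsum n x.
Proof. by apply: sumr_ge0 => i _; exact: powR_ge0. Qed.

Lemma latnorm_le_scaled n x (t : R) : (0 < n)%N -> 0 <= t ->
  (latnorm R d q x <= n%:R * t `^ q^-1) = (scaledsum n x <= t).
Proof.
move=> n0 t0; have nR : 0 < n%:R :> R by rewrite ltr0n.
rewrite mulrC -ler_pdivrMr // -[RHS]ler_powR_inv ?scaledsum_ge0 //; congr (_ <= _).
rewrite /latnorm /scaledsum.
under [in RHS]eq_bigr do rewrite powRM ?invr_ge0 ?ler0n //.
rewrite -mulr_suml powRM ?powR_ge0 ?latnorm_sum_ge0 //.
by rewrite powR_invK // invr_ge0 ltW.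
Qed.

Lemma latcountE (P : pred ('I_d -> nat)) (M : nat) :
  (latcount d P M)%:R = \sum_(x : {ffun 'I_d -> 'I_M.+1}) (P (fun i => x i : nat))%:R :> R.
Proof.
rewrite /latcount -sum1_card big_mkcond natr_sum; apply: eq_bigr => x _.
by rewrite inE; case: (P _).
Qed.

(** The scaled count of points with [scaledsum] at most [t], weighted by [exp(-t)]. It is kept as a
    finite sum for termwise integration; the side [n ^ 2] lets the box, scaled by [1/n], exhaust the
    orthant. *)
Definition boxed n (t : R) : R := \sum_(x : {ffun 'I_d -> 'I_(n ^ 2).+1})
  (n%:R ^+ d)^-1 * (expR (- t) * (scaledsum n (fun i => x i : nat) <= t)%R%:R).

(** A Riemann sum of mesh [1/n] for [exp(-u^q)] on [[0, n]]. It does not depend on [d]. *)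
Definition riemann n : R := n%:R^-1 * \sum_(k < (n ^ 2).+1) expR (- ((k%:R / n%:R) `^ q)).

Lemma measurable_boxed n : measurable_fun D (boxed n).
Proof.
apply: measurable_sum => x; apply: measurable_funM => //.
by apply: measurable_funM; [exact: measurable_expRN|exact: measurable_step].
Qed.

(** Each term integrates to [exp(- scaledsum)], a product over the coordinates, so the sum over the
    box is a [d]-th power. *)
Lemma integral_boxed n : (\int[mu]_(t in D) (boxed n t)%:E = (riemann n ^+ d)%:E)%E.
Proof.
under eq_integral do rewrite /boxed -sumEFin.
rewrite ge0_integral_sum //; last first.
  move=> x; apply/measurable_EFinP; apply: measurable_funM => //.
  by apply: measurable_funM; [exact: measurable_expRN|exact: measurable_step].
under eq_bigr => x _.
  under eq_integral do rewrite EFinM.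
  rewrite ge0_integralZl_EFin //; last first.
    apply/measurable_EFinP.
    by apply: measurable_funM; [exact: measurable_expRN|exact: measurable_step].
  rewrite integral_expRN_step ?scaledsum_ge0 // -EFinM.
  over.
rewrite sumEFin -mulr_sumr; congr (_%:E).
rewrite /riemann exprMn exprVn; congr (_ * _).
rewrite -[in RHS](card_ord d) -prodr_const bigA_distr_bigA.
by apply: eq_bigr => x _; rewrite /scaledsum -sumrN expR_sum.
Qed.

Lemma boxedE n (t : R) : (0 < n)%N -> 0 <= t ->
  boxed n t = expR (- t) *
    ((latcount d (fun x => latnorm R d q x <= n%:R * t `^ q^-1) (n ^ 2))%:R / n%:R ^+ d).
Proof.
move=> n0 t0; rewrite /boxed -mulr_sumr -mulr_sumr latcountE mulrCA; congr (_ * _).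
rewrite mulrC; congr (_ / _); apply: eq_bigr => x _.
by rewrite latnorm_le_scaled.
Qed.

Lemma latcount_le_latball (M : nat) (r : R) :
  (latcount d (fun x => latnorm R d q x <= r)%R M <= latball R d q r)%N.
Proof.
apply: (latcount_le _ _ _ _ _ id id) => x xr _; split => // i.
exact: (coord_le_trunc _ _ _ q1).
Qed.

Lemma boxed_le n (t : R) : (0 < n)%N -> (0 < d)%N -> 0 < t ->
  0 <= boxed n t <= expdom R d t.
Proof.
move=> n0 d0 t0; have nR : 0 < n%:R :> R by rewrite ltr0n.
rewrite boxedE ?(ltW t0) //; apply/andP; split.
  by rewrite !mulr_ge0 ?expR_ge0 ?invr_ge0 ?exprn_ge0 ?ler0n.
apply: le_trans (powR_le_expdom _ _ _ _ d0 q1 t0).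
rewrite ler_pM2l ?expR_gt0 // ler_pdivrMr ?exprn_gt0 // -exprMn.
have r0 : 0 <= n%:R * t `^ q^-1 by rewrite mulr_ge0 ?powR_ge0 ?ler0n.
apply: (@le_trans _ _ (latball R d q (n%:R * t `^ q^-1))%:R).
  by rewrite ler_nat latcount_le_latball.
apply: le_trans (latball_le_exp _ _ _ _ r0) _.
rewrite lerXn2r ?nnegrE ?addr_ge0 ?mulr_ge0 ?addr_ge0 ?powR_ge0 ?ler0n //.
by rewrite mulrDl mul1r mulrC lerD2l ler1n.
Qed.

(** Once [n >= t^(1/q)], the box of side [n ^ 2] contains the ball of radius [n * t^(1/q)], and the
    limit density of [latball] applies. *)
Lemma boxed_cvg (t : R) : 0 < t ->
  boxed n t @[n --> \oo] --> latvol R d q * (t `^ (d%:R / q) * expR (- t)).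
Proof.
move=> t0; have tq0 : 0 < t `^ q^-1 by rewrite powR_gt0.
have ry : n%:R * t `^ q^-1 @[n --> \oo] --> +oo%R.
  apply/cvgryPge => A; near=> n; rewrite -ler_pdivrMr //.
  by near: n; exact: nbhs_infty_ger.
have c1 := cvg_comp _ _ ry (latball_cvg R d q q1).
have -> : latvol R d q * (t `^ (d%:R / q) * expR (- t)) =
    expR (- t) * (latvol R d q * (t `^ q^-1) ^+ d).
  by rewrite powR_divn ?(ltW t0) // mulrA mulrC.
apply: cvg_trans (cvgMr (cvgMl c1)); apply: near_eq_cvg; near=> n.
have n0 : (0 < n)%N by near: n; exact: nbhs_infty_gt.
have nR : 0 < n%:R :> R by rewrite ltr0n.
have nt : t `^ q^-1 <= n%:R.
  by near: n; exact: nbhs_infty_ger.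
rewrite boxedE ?(ltW t0) //; congr (_ * _) => /=.
rewrite (latball_box _ _ _ q1 (n ^ 2)); last first.
  rewrite truncn_le_nat; apply: (@le_lt_trans _ _ (n ^ 2)%:R); last by rewrite ltr_nat.
  by rewrite natrX expr2 ler_pM2l.
rewrite exprMn invfM -mulrA; congr (_ * _).
by rewrite divfK // expf_neq0 // gt_eqF.
Unshelve. all: by end_near. Qed.

Lemma riemann_cvg : (0 < d)%N ->
  riemann n ^+ d @[n --> \oo] --> latvol R d q * Gamma (d%:R / q + 1).
Proof.
move=> d0.
have mD : measurable (D : set (g_sigma_algebraType R.-ocitv.-measurable)).
  exact: measurable_itv.
have [|||||_ _] := @dominated_convergence _ _ R mu D mD
    (* The shift to [n.+1] is there because the domination is available for positive indices. *)
    (fun n t => (boxed n.+1 t)%:E)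
    (fun t => (latvol R d q * (t `^ (d%:R / q) * expR (- t)))%:E)
    (EFin \o expdom R d).
  - by move=> n; apply/measurable_EFinP; exact: measurable_boxed.
  - by apply/measurable_EFinP; apply: measurable_funM => //; exact: measurable_gammaf.
  - apply: aeW => t; rewrite /= in_itv /= andbT => t0; apply: cvg_EFin.
      by apply: nearW.
    rewrite (cvg_shiftS (fun n => boxed n t)).
    exact: boxed_cvg.
  - exact: expdom_integrable.
  - apply: aeW => t n; rewrite /= in_itv /= andbT => t0.
    by have /andP[b0 bd] := boxed_le n.+1 t isT d0 t0; rewrite lee_fin ger0_norm.
rewrite [X in X @ _](_ : _ = fun n => (riemann n.+1 ^+ d)%:E); last first.
  by apply/funext => n; exact: integral_boxed.
rewrite [X in _ --> X](_ : _ = (latvol R d q * Gamma (d%:R / q + 1))%:E); last first.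
  under eq_integral do rewrite EFinM.
  rewrite ge0_integralZl_EFin //.
  - by rewrite GammaE // EFinM.
  - by move=> t _; rewrite lee_fin mulr_ge0 ?powR_ge0 ?expR_ge0.
  - by apply/measurable_EFinP; exact: measurable_gammaf.
  - exact: latvol_ge0.
move=> /fine_cvg H; rewrite -(cvg_shiftS (fun n => riemann n ^+ d)).
exact: H.
Qed.

End LatticeVolume.

(** * Evaluation of the volume constant by Gamma values *)

Section LatticeVolumeGamma.
Variables (R : realType) (q : R).
Hypothesis q1 : 1 <= q.

Lemma latball1 (r : R) : 0 <= r -> latball R 1 q r = (Num.truncn r).+1.
Proof.
move=> r0; rewrite /latball /latcount.
rewrite (_ : [set _ | _]%SET = [set: {ffun 'I_1 -> 'I_(Num.truncn r).+1}]%SET).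
  by rewrite cardsT card_ffun !card_ord expn1.
apply/setP => x; rewrite !inE /latnorm big_ord1 powR_invK // ?ler0n //.
apply: (@le_trans _ _ (Num.truncn r)%:R); first by rewrite ler_nat -ltnS.
by rewrite truncn_le.
Qed.

Lemma latvol1 : latvol R 1 q = 1.
Proof.
apply/eqP; rewrite eq_le; apply/andP; split; last first.
  apply: lb_le_inf; first exact: (latvol_lbound R 1 q).1.
  move=> _ [r /= r0 <-]; rewrite latball1 ?(ltW r0) // expr1 ler_pdivlMr // mul1r.
  by rewrite ltW // truncnS_gt.
rewrite leNgt; apply/negP => V1; have V0 : 0 < latvol R 1 q - 1 by rewrite subr_gt0.
(* With [V > 1] and this radius [r], the difference [V * r - (r + 1)] equals 1, against the bound
   [r + 1] on the count. *)
have r0 : 0 < 2 / (latvol R 1 q - 1) by rewrite divr_gt0.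
have := latvol_le R 1 q _ r0; apply/negP; rewrite -ltNge.
rewrite expr1 ltr_pdivrMr //.
apply: (@le_lt_trans _ _ (2 / (latvol R 1 q - 1) + 1)).
  rewrite -[X in _ <= _ + X]expr1 -[leRHS]expr1.
  apply: le_trans (latball_le_exp _ _ _ _ (ltW r0)) _.
  by rewrite !expr1.
set V := latvol R 1 q in V0 *.
suff : 0 < V * (2 / (V - 1)) - (2 / (V - 1) + 1) by rewrite subr_gt0.
have -> : V * (2 / (V - 1)) - (2 / (V - 1) + 1) = 1 :> R.
  by field; rewrite gt_eqF.
exact: ltr01.
Qed.

(** The same sums [riemann] serve every dimension: dimension 1 yields their limit, and its [d]-th
    power must agree with the limit found in dimension [d]. *)
Lemma latvol_Gamma (d : nat) : (0 < d)%N ->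
  latvol R d q = Gamma (q^-1 + 1) ^+ d / Gamma (d%:R / q + 1).
Proof.
move=> d0; have := riemann_cvg R q q1 1 isT.
rewrite latvol1 mul1r div1r => c1.
have cd := cvg_comp _ _ c1 (@exprn_continuous R d (Gamma (q^-1 + 1))).
apply: (mulIf (lt0r_neq0 (Gamma_gt0 R d q d0 q1))).
rewrite divfK ?gt_eqF ?Gamma_gt0 //.
apply: cvg_unique (riemann_cvg R q q1 d d0) _ => //.
Qed.

End LatticeVolumeGamma.

(** * Primitive zonotopes *)

Section PrimitiveZonotope.
Variables (R : realType) (d : nat).

Lemma zonotope_ord_recl (n : nat) (g : 'I_n.+1 -> 'rV[R]_d) :
  zonotope R d _ g = minkowski_sum (segment 0 (g ord0))
    (zonotope R d _ (fun i => g (lift ord0 i))).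
Proof.
apply/seteqP; split => x.
- move=> [t t01 <-]; rewrite big_ord_recl; exists (t ord0 *: g ord0).
    by exists (t ord0); rewrite /= ?t01 // scaler0 add0r.
  by exists (\sum_i t (lift ord0 i) *: g (lift ord0 i)) => //; exists (fun i => t (lift ord0 i)).
- move=> [_ [r r01 <-] [_ [t t01 <-] <-]].
  exists (fun i => if unlift ord0 i is Some j then t j else r).
    by move=> i /=; case: unlift => [j|]; [exact: t01|exact: r01].
  rewrite big_ord_recl unlift_none scaler0 add0r; congr (_ + _).
  by apply: eq_bigr => i _; rewrite liftK.
Qed.

Lemma minkowski_sum_segments (T : Type) (x0 : T) (s : seq T) (g : T -> 'rV[R]_d) :
  \big[@minkowski_sum R d/[set 0]]_(x <- s) segment 0 (g x) =
  zonotope R d _ (fun i : 'I_(size s) => g (nth x0 s i)).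
Proof.
elim: s => [|x s IH]; last by rewrite big_cons IH zonotope_ord_recl.
rewrite big_nil; apply/seteqP; split => y /=.
  by move=> ->; exists (fun=> 0); rewrite ?big_ord0 // => i; rewrite lexx ler01.
by move=> [t _ <-]; rewrite big_ord0.
Qed.

Variables (q p : R).
Hypothesis q1 : 1 <= q.
Implicit Types x y : 'rV[int]_d.

Local Notation nat_coord x := (fun i => absz (x 0 i)).

Lemma qnorm_latnorm x : qnorm q (int_point R x) = latnorm R d q (nat_coord x).
Proof.
rewrite /qnorm /latnorm; congr (_ `^ _); apply: eq_bigr => i _.
by rewrite mxE -intr_norm natr_absz.
Qed.

Lemma generators_neq0 x : generators q p x -> int_point R x != 0.
Proof.
move=> [[x0 _] _ _]; apply/eqP => /rowP E; apply: x0; apply/rowP => i.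
by have := E i; rewrite !mxE => /eqP; rewrite intr_eq0 => /eqP.
Qed.

(** The all-ones functional provides the open half-space that [zonotope_diameter] asks for. *)
Lemma generators_dotp1 x : generators q p x -> 0 < dotp (const_mx 1) (int_point R x).
Proof.
move=> gx; have [_ _ xge0] := gx; rewrite lt_neqAle; apply/andP; split; last first.
  by apply: sumr_ge0 => i _; rewrite !mxE mul1r ler0z.
apply/eqP => /esym/psumr_eq0P E; have := generators_neq0 x gx.
rewrite (_ : int_point R x = 0) ?eqxx //; apply/rowP => i.
have := E _ i isT; rewrite !mxE mul1r; apply => j _.
by rewrite !mxE mul1r ler0z.
Qed.

(* If x_i y_j = x_j y_i for all i and j, taking the gcd over j gives x_i = y_i. *)
Lemma generators_indep x y (a b : R) : generators q p x -> generators q p y ->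
  x != y -> a *: int_point R x + b *: int_point R y = 0 -> a = 0 /\ b = 0.
Proof.
move=> gx gy xy /rowP E.
have {}E i : a * (x 0 i)%:~R + b * (y 0 i)%:~R = 0 by have := E i; rewrite !mxE.
have [a0|an0] := eqVneq a 0.
  split=> //; apply/eqP; apply: contraTT (generators_neq0 y gy) => bn0.
  rewrite negbK; apply/eqP/rowP => i; rewrite !mxE.
  by have /eqP := E i; rewrite a0 mul0r add0r mulf_eq0 (negPf bn0) => /eqP.
have [[_ gcdx] _ xge0] := gx; have [[_ gcdy] _ yge0] := gy.
(* Substituting [a x = - b y] turns [a * x_i * y_j] into [- b * y_i * y_j], which is symmetric in
   [i] and [j]; then [a] is cancelled. *)
have cross i j : (x 0 i * y 0 j = x 0 j * y 0 i)%R.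
  apply/eqP; rewrite -(eqr_int R) !intrM -subr_eq0 -(mulrI_eq0 _ (lregP an0)).
  have Ei : a * (x 0 i)%:~R = - (b * (y 0 i)%:~R) by apply/eqP; rewrite -addr_eq0 E.
  have Ej : a * (x 0 j)%:~R = - (b * (y 0 j)%:~R) by apply/eqP; rewrite -addr_eq0 E.
  by rewrite mulrBr !mulrA Ei Ej; apply/eqP; ring.
case/eqP: xy; apply/rowP => i.
suff : absz (x 0 i) = absz (y 0 i).
  by move=> /(congr1 Posz); rewrite !gez0_abs.
have Ex := gcd_coordM d (absz (x 0 i)) (nat_coord y).
have Ey := gcd_coordM d (absz (y 0 i)) (nat_coord x).
rewrite gcdy muln1 in Ex; rewrite gcdx muln1 in Ey; rewrite -Ex -Ey.
by apply: eq_bigr => j _; rewrite -!abszM cross mulrC.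
Qed.

(** * Enumeration of the generators *)

Definition box_point (M : nat) (f : {ffun 'I_d -> 'I_M.+1}) : 'rV[int]_d :=
  \row_i (f i : nat)%:Z.

Lemma box_point_inj M : injective (@box_point M).
Proof.
move=> f g /rowP E; apply/ffunP => i; apply: val_inj.
by have := E i; rewrite !mxE => -[].
Qed.

(** The very set whose cardinality defines [primball], so the two counts agree by conversion. *)
Definition gen_box : {set {ffun 'I_d -> 'I_(Num.truncn p).+1}} :=
  [set f : {ffun 'I_d -> 'I_(Num.truncn p).+1} |
           (latnorm R d q (fun i => f i : nat) <= p) &&
           (\big[gcdn/0%N]_i (f i : nat) == 1)%N]%SET.

Lemma generators_box x :
  generators q p x <-> x \in [seq box_point _ f | f <- enum gen_box].
Proof.
split.
- move=> [[_ gcdx] xp xge0]; rewrite qnorm_latnorm in xp.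
  have xM i := coord_le_trunc R d q q1 (nat_coord x) i p xp.
  pose f : {ffun 'I_d -> 'I_(Num.truncn p).+1} := [ffun i => inord (absz (x 0 i))].
  have fE i : f i = absz (x 0 i) :> nat by rewrite ffunE inordK ?ltnS // xM.
  apply/mapP; exists f; last first.
    by apply/rowP => i; rewrite mxE fE gez0_abs.
  rewrite mem_enum inE; apply/andP; split.
    by under eq_fun do rewrite fE.
  by under eq_bigr do rewrite fE; rewrite gcdx.
- move=> /mapP[f]; rewrite mem_enum inE => /andP[fp /eqP gcdf] ->.
  have E i : absz (box_point _ f 0 i) = f i by rewrite mxE.
  split; last by move=> i; rewrite mxE.
    split; last by under eq_bigr do rewrite E.
    move=> f0; move: gcdf; rewrite big1 // => i _.
    by rewrite -E f0 mxE.
  by rewrite qnorm_latnorm; under eq_fun do rewrite E.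
Qed.

Lemma diameter_Hplus : diameter (Hplus d q p) = ((primball R d q p)%:R)%:E.
Proof.
rewrite /Hplus; set F := fun x => segment 0 (int_point R x).
(* The big operator runs over the indices whose segment differs from the neutral element [[set 0]];
   nonzero generators all qualify, so none is lost. *)
have suppE : generators q p `&` F @^-1` [set~ [set 0]] = generators q p.
  apply/seteqP; split => [x []//|x gx]; split => //= /seteqP[F0 _].
  have := generators_neq0 x gx; rewrite (F0 (int_point R x)) ?eqxx //.
  by exists 1; rewrite /= ?ler01 ?lexx // scaler0 add0r scale1r.
have fing : finite_set (generators q p : set 'rV[int]_d).
  apply: sub_finite_set (finite_seq [seq box_point _ f | f <- enum gen_box]).
  by move=> x /generators_box.
set s := (X in \big[_/_]_(x <- X) _).
have sE x : (x \in s) = `[< generators q p x >].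
  by rewrite /s in_finite_support suppE.
have us : uniq s by exact: finite_support_uniq.
have sz : size s = primball R d q p.
  have /perm_size -> : perm_eq s [seq box_point _ f | f <- enum gen_box].
    apply: uniq_perm => //.
      by rewrite map_inj_uniq ?enum_uniq //; exact: box_point_inj.
    by move=> x; rewrite sE; apply/asboolP/idP => /generators_box.
  by rewrite size_map -cardE.
rewrite (minkowski_sum_segments _ 0) -sz.
have gs (i : 'I_(size s)) : generators q p (nth 0 s i).
  by apply/asboolP; rewrite -sE mem_nth.
rewrite (zonotope_diameter _ _ _ _ _ _ (const_mx 1)) ?card_ord //.
- by move=> i; exact: generators_neq0 (gs i).
- move=> i j a b ij; apply: generators_indep (gs i) (gs j) _.
  by rewrite nth_uniq.
- by move=> i; exact: generators_dotp1 (gs i).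
Qed.

End PrimitiveZonotope.

Theorem theorem2p3 (R : realType) (d : nat) (q : R)
  (hd : (2 <= d)%N) (hq : 1 <= q) :
  (diameter (Hplus d q p) / (p ^+ d)%:E)%E @[p --> +oo%R] -->
  (Gamma (q^-1 + 1) ^+ d / (Gamma (d%:R / q + 1) * zeta (d%:R : R)))%:E.
Proof.
have d0 : (0 < d)%N by exact: leq_trans hd.
have -> : Gamma (q^-1 + 1) ^+ d / (Gamma (d%:R / q + 1) * zeta (d%:R : R)) =
    latvol R d q / zeta (d%:R : R).
  by rewrite latvol_Gamma // invfM mulrA.
have cvgE : ((primball R d q p)%:R / p ^+ d)%:E @[p --> +oo%R] -->
    (latvol R d q / zeta (d%:R : R))%:E.
  by apply: cvg_EFin; [exact: nearW|exact: primball_cvg].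
apply: cvg_trans cvgE; apply: near_eq_cvg; near=> p.
have p0 : 0 < p by near: p; apply: nbhs_pinfty_gt; rewrite num_real.
(* Positivity of [p] makes [p ^ d] nonzero, so the extended real inverse is the real one. *)
by rewrite diameter_Hplus // EFinM inver gt_eqF // exprn_gt0.
Unshelve. all: by end_near. Qed.
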